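(* Let $\mathbf{L}\in\mathbb{R}^{n\times n}$ be symmetric with spectrum in $[0,\Lambda]$, $\Lambda>0$, let $\mathrm{E}_W\in\mathbb{R}^{n\times N}$ be a block of $N$ distinct canonical unit vectors of $\mathbb{R}^n$, let $\mathrm{y}=[y_1,\ldots,y_N]^*\in\mathbb{R}^N$, and let $\gamma\ge 0$. Let $\mathrm{kr}\in\{\mathrm{cbl},\mathrm{gbl},\mathrm{sbl},\mathrm{cheb},\mathrm{cheb}^2\}$ and let $\phi$ be continuous and positive on $[0,\Lambda]$ with $$\phi_{\min}=\min_{\lambda\in[0,\Lambda]}|\phi(\lambda)|,\qquad \phi_{\max}=\max_{\lambda\in[0,\Lambda]}|\phi(\lambda)|.$$ Suppose that $p_{\phi,m-1}^{(\mathrm{kr})}(\mathbf{L})\mathrm{E}_W$ converges to $\phi(\mathbf{L})\mathrm{E}_W$ as $m\to\infty$. Let $y$ be the regularized least squares (RLS) kernel predictor and $y^{(\mathrm{kr})}$ (depending on $m$) the approximate RLS predictor. Then, for $m\to\infty$, $$\|y-y^{(\mathrm{kr})}\|_2\ \dot{\leq}\ \frac{\|\mathrm{y}\|_2}{\phi_{\min}+\gamma N}\left(1+\frac{\phi_{\max}}{\phi_{\min}+\gamma N}\right)\left\|\phi(\mathbf{L})\mathrm{E}_W-p_{\phi,m-1}^{(\mathrm{kr})}(\mathbf{L})\mathrm{E}_W\right\|_2 ,$$ where $\dot{\leq}$ means inequality up to terms of second order: writing $\delta_m=\|\phi(\mathbf{L})\mathrm{E}_W-p_{\phi,m-1}^{(\mathrm{kr})}(\mathbf{L})\mathrm{E}_W\|_2$,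 the left-hand side is at most the right-hand side plus $\mathcal{O}(\delta_m^2)$, for all sufficiently large $m$.
   Context: $A^*$ denotes the transpose; $\|\cdot\|_2$ is the Euclidean norm for vectors and the spectral norm for matrices; $\|\cdot\|_F$ is the Frobenius norm. For a symmetric matrix $M$ with spectrum in $[0,\Lambda]$, $\phi(M)$ is defined through the spectral decomposition. $\mathrm{E}_W=[e_{\mathrm{w}_1},\ldots,e_{\mathrm{w}_N}]$. Each expression $p_{\phi,m-1}^{(\mathrm{kr})}(\mathbf{L})\mathrm{E}_W$ for a Lanczos method is one symbol for an $n\times N$ matrix. Predictors. $y=\phi(\mathbf{L})\mathrm{E}_W\,\mathrm{c}\in\mathbb{R}^n$, where $\mathrm{c}\in\mathbb{R}^N$ solves $(\mathrm{E}_W^*\phi(\mathbf{L})\mathrm{E}_W+\gamma N\mathbf{I}_N)\mathrm{c}=\mathrm{y}$. Similarly $y^{(\mathrm{kr})}=p_{\phi,m-1}^{(\mathrm{kr})}(\mathbf{L})\mathrm{E}_W\,\mathrm{c}^{(\mathrm{kr})}$, where $\mathrm{c}^{(\mathrm{kr})}\in\mathbb{R}^N$ solves $(\mathrm{E}_W^*p_{\phi,m-1}^{(\mathrm{kr})}(\mathbf{L})\mathrm{E}_W+\gamma N\mathbf{I}_N)\mathrm{c}^{(\mathrm{kr})}=\mathrm{y}$. (cbl) Classical block Lanczos. Set $\mathrm{Q}_0=0$, $\mathrm{H}_{0,1}=0$, $\mathrm{Q}_1=\mathrm{E}_W$. For $k=1,2,\ldots$: $\mathrm{X}=\mathbf{L}\mathrm{Q}_k-\mathrm{Q}_{k-1}\mathrm{H}_{k-1,k}$,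 $\mathrm{H}_{k,k}=\mathrm{Q}_k^*\mathrm{X}$, replace $\mathrm{X}$ by $\mathrm{X}-\mathrm{Q}_k\mathrm{H}_{k,k}$, compute a reduced QR decomposition $\mathrm{X}=\mathrm{Q}_{k+1}\mathrm{H}_{k+1,k}$ ($\mathrm{Q}_{k+1}\in\mathbb{R}^{n\times N}$ with orthonormal columns, $\mathrm{H}_{k+1,k}\in\mathbb{R}^{N\times N}$ upper triangular), and set $\mathrm{H}_{k,k+1}=\mathrm{H}_{k+1,k}^*$. Let $\mathbf{H}_m\in\mathbb{R}^{mN\times mN}$ be the block tridiagonal matrix with blocks $\mathrm{H}_{i,j}$, $|i-j|\le1$, $1\le i,j\le m$, and $\mathrm{F}_1\in\mathbb{R}^{mN\times N}$ the matrix with first $N\times N$ block $\mathbf{I}_N$ and zeros elsewhere. Then $p_{\phi,m-1}^{(\mathrm{cbl})}(\mathbf{L})\mathrm{E}_W:=[\mathrm{Q}_1,\ldots,\mathrm{Q}_m]\phi(\mathbf{H}_m)\mathrm{F}_1$, as long as $\mathrm{H}_{k+1,k}$ is invertible for $k\le m-1$. For $m$ beyond such a breakdown the iterate is understood as $V\phi(V^*\mathbf{L}V)V^*\mathrm{E}_W$, where the columns of $V$ are an orthonormal basis of the span of all columns of $\mathrm{E}_W,\mathbf{L}\mathrm{E}_W,\ldots,\mathbf{L}^{m-1}\mathrm{E}_W$ (this agrees with the previous formula when there is no breakdown). (gbl) Global block Lanczos. Set $\mathrm{Q}_0=0$, $h_{0,1}=0$, $\mathrm{Q}_1=\mathrm{E}_W/\sqrt{N}$.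 For $k=1,2,\ldots$: $\mathrm{X}=\mathbf{L}\mathrm{Q}_k-h_{k-1,k}\mathrm{Q}_{k-1}$, $h_{k,k}=\operatorname{tr}(\mathrm{Q}_k^*\mathrm{X})$, replace $\mathrm{X}$ by $\mathrm{X}-h_{k,k}\mathrm{Q}_k$, $h_{k+1,k}=h_{k,k+1}=\|\mathrm{X}\|_F$, $\mathrm{Q}_{k+1}=\mathrm{X}/h_{k+1,k}$. Let $\mathbf{H}_m\in\mathbb{R}^{m\times m}$ be the symmetric tridiagonal matrix with entries $h_{i,j}$, $f_1$ the first canonical vector of $\mathbb{R}^m$, and $u=\sqrt{N}\,\phi(\mathbf{H}_m)f_1$. Then $p_{\phi,m-1}^{(\mathrm{gbl})}(\mathbf{L})\mathrm{E}_W:=\sum_{k=1}^m u_k\mathrm{Q}_k$. If $h_{k+1,k}=0$ occurs for the first time at $k$, the iterates for all larger $m$ are kept equal to the one for $m=k$. (sbl) Sequential Lanczos. For each $i$, run the ordinary Lanczos method (the global method with $N=1$, including the convention at termination) with starting vector $e_{\mathrm{w}_i}$, giving vectors $q_1^{(\mathrm{w}_i)},\ldots,q_m^{(\mathrm{w}_i)}$ and a tridiagonal matrix $\mathbf{H}_m^{(\mathrm{w}_i)}$. The $i$-th column of $p_{\phi,m-1}^{(\mathrm{sbl})}(\mathbf{L})\mathrm{E}_W$ is $[q_1^{(\mathrm{w}_i)},\ldots,q_m^{(\mathrm{w}_i)}]\,\phi(\mathbf{H}_m^{(\mathrm{w}_i)})f_1$. (cheb) For $m\ge1$, $p_{\phi,m}^{(\mathrm{cheb})}$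 is the polynomial of degree at most $m$ interpolating $\phi$ at the points $\frac{\Lambda}{2}\left(1-\cos\frac{\pi j}{m}\right)$, $j=0,\ldots,m$; $p_{\phi,m}^{(\mathrm{cheb})}(\mathbf{L})\mathrm{E}_W$ is this polynomial evaluated at $\mathbf{L}$, times $\mathrm{E}_W$. (cheb$^2$) $p_{\phi,m}^{(\mathrm{cheb}^2)}(\lambda)=\left(p_{\phi^{1/2},\lfloor m/2\rfloor}^{(\mathrm{cheb})}(\lambda)\right)^2$, where $\phi^{1/2}=\sqrt{\phi}$ (for $m\ge2$), evaluated at $\mathbf{L}$ and multiplied by $\mathrm{E}_W$. *)

(* Defs.v *)
From HB Require Import structures.
#[export] Set Warnings "-notation-overridden,-notation-incompatible-prefix".
From mathcomp Require Export all_boot all_order all_algebra.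
#[export] Set Warnings "-notation-overridden,-notation-incompatible-prefix".
From mathcomp Require Export all_classical all_reals all_analysis.
Export Order.TTheory GRing.Theory Num.Theory.
Export numFieldNormedType.Exports.

Set Implicit Arguments.
Unset Strict Implicit.
Unset Printing Implicit Defensive.

Local Open Scope classical_set_scope.
Local Open Scope ring_scope.

Definition is_min (R : realType) (A : set R) (a : R) : Prop := A a /\ lbound A a.
Definition is_max (R : realType) (A : set R) (a : R) : Prop := A a /\ ubound A a.

Definition l2norm (R : realType) (n : nat) (x : 'cV[R]_n) : R :=
  Num.sqrt (\sum_i x i 0 ^+ 2).

Definition spectral_norm (R : realType) (m n : nat) (A : 'M[R]_(m, n)) : R :=
  sup [set l2norm (A *m x) | x in [set x : 'cV[R]_n | l2norm x <= 1]].

Definition frobenius_norm (R : realType) (m n : nat) (A : 'M[R]_(m, n)) : R :=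
  Num.sqrt (\sum_i \sum_j A i j ^+ 2).

(* For symmetric M the set below is a singleton: a spectral decomposition
   exists, and the value does not depend on which one is used. The default 0
   is only reached when M is not symmetric. *)
Definition mxfun (R : realType) (n : nat) (phi : R -> R) (M : 'M[R]_n) : 'M[R]_n :=
  xget 0 [set B | exists (U : 'M[R]_n) (d : 'rV[R]_n),
    [/\ U^T *m U = 1%:M, M = U *m diag_mx d *m U^T
      & B = U *m diag_mx (map_mx phi d) *m U^T]].

Definition unit_block (R : realType) (n N : nat) (w : 'I_N -> 'I_n) :
    'M[R]_(n, N) :=
  \matrix_(i, j) (i == w j)%:R.

Definition is_rls_predictor (R : realType) (n N : nat) (E A : 'M[R]_(n, N))
    (gamma : R) (yy : 'cV[R]_N) (y : 'cV[R]_n) : Prop :=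
  exists2 c : 'cV[R]_N,
    (E^T *m A + (gamma * N%:R)%:M) *m c = yy & y = A *m c.

(* Blocks and coefficients are numbered from 1 in the recurrences: Q k is the
   k-th block, h i j the coefficient with indices i and j. Index 0 is only
   used for the initial values. *)

Definition reduced_qr (R : realType) (n N : nat) (X Q : 'M[R]_(n, N))
    (H : 'M[R]_N) : Prop :=
  [/\ X = Q *m H, Q^T *m Q = 1%:M
    & forall i j : 'I_N, (j < i)%N -> H i j = 0].

(* Reduced QR decompositions exist also for rank-deficient X (N <= n), so runs
   never stop; what is computed after a breakdown is not used. *)
Definition cbl_run (R : realType) (n N : nat) (L : 'M[R]_n) (E : 'M[R]_(n, N))
    (Q : nat -> 'M[R]_(n, N)) (H : nat -> nat -> 'M[R]_N) : Prop :=
  [/\ Q 0%N = 0, H 0%N 1%N = 0, Q 1%N = E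
    & forall k : nat, (0 < k)%N ->
      let X := L *m Q k - Q k.-1 *m H k.-1 k in
      [/\ H k k = (Q k)^T *m X,
          reduced_qr (X - Q k *m H k k) (Q k.+1) (H k.+1 k)
        & H k k.+1 = (H k.+1 k)^T]].

Definition block_tridiag (R : realType) (N : nat) (H : nat -> nat -> 'M[R]_N)
    (m : nat) : 'M[R]_(\sum_(i < m) N) :=
  \mxblock_(i < m, j < m)
    (if (i <= j.+1)%N && (j <= i.+1)%N then H i.+1 j.+1 else 0).

Definition first_block (R : realType) (N m : nat) : 'M[R]_(\sum_(i < m) N, N) :=
  \mxcol_(i < m) (if (i : nat) == 0%N then 1%:M else 0 : 'M[R]_N).

Definition block_krylov (R : realType) (n N : nat) (L : 'M[R]_n)
    (E : 'M[R]_(n, N)) (m : nat) : 'M[R]_(n, \sum_(i < m) N) :=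
  \mxrow_(i < m) iter i (mulmx L) E.

(* P is a value of p_{phi,m-1}^(cbl)(L) E. A relation, because the QR
   decompositions and the orthonormal basis V may be chosen freely. *)
Definition cbl_iterate (R : realType) (n N : nat) (phi : R -> R) (L : 'M[R]_n)
    (E : 'M[R]_(n, N)) (m : nat) (P : 'M[R]_(n, N)) : Prop :=
  exists Q H, cbl_run L E Q H /\
    if [forall k : 'I_m.-1, H k.+2 k.+1 \in unitmx] then
      P = (\mxrow_(j < m) Q j.+1) *m mxfun phi (block_tridiag H m)
            *m first_block R N m
    else
      exists r (V : 'M[R]_(n, r)),
        [/\ V^T *m V = 1%:M, (V^T :=: (block_krylov L E m)^T)%MS
          & P = V *m mxfun phi (V^T *m L *m V) *m V^T *m E].

(* Inverses of 0 are 0, so a run consists of zeros after a breakdown. *)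
Definition gbl_run (R : realType) (n N : nat) (L : 'M[R]_n) (E : 'M[R]_(n, N))
    (Q : nat -> 'M[R]_(n, N)) (h : nat -> nat -> R) : Prop :=
  [/\ Q 0%N = 0, h 0%N 1%N = 0, Q 1%N = (Num.sqrt N%:R)^-1 *: E
    & forall k : nat, (0 < k)%N ->
      let X := L *m Q k - h k.-1 k *: Q k.-1 in
      [/\ h k k = \tr ((Q k)^T *m X),
          h k.+1 k = frobenius_norm (X - h k k *: Q k),
          h k k.+1 = h k.+1 k
        & Q k.+1 = (h k.+1 k)^-1 *: (X - h k k *: Q k)]].

Definition tridiag (R : realType) (h : nat -> nat -> R) (m : nat) : 'M[R]_m :=
  \matrix_(i, j) (if (i <= j.+1)%N && (j <= i.+1)%N then h i.+1 j.+1 else 0).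

(* For m >= 1: the first k in 1..m-1 with h_{k+1,k} = 0, and m if there is
   none. *)
Definition gbl_length (R : realType) (h : nat -> nat -> R) (m : nat) : nat :=
  (find (fun k => h k.+2 k.+1 == 0%R) (iota 0 m.-1)).+1.

Definition gbl_sum (R : realType) (n N : nat) (phi : R -> R)
    (Q : nat -> 'M[R]_(n, N)) (h : nat -> nat -> R) (m : nat) : 'M[R]_(n, N) :=
  let f1 : 'cV[R]_m := \col_i ((i : nat) == 0%N)%:R in
  let u := Num.sqrt N%:R *: (mxfun phi (tridiag h m) *m f1) in
  \sum_(k < m) u k 0 *: Q k.+1.

Definition gbl_iterate (R : realType) (n N : nat) (phi : R -> R) (L : 'M[R]_n)
    (E : 'M[R]_(n, N)) (m : nat) (P : 'M[R]_(n, N)) : Prop :=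
  exists Q h, gbl_run L E Q h /\ P = gbl_sum phi Q h (gbl_length h m).

Definition sbl_iterate (R : realType) (n N : nat) (phi : R -> R) (L : 'M[R]_n)
    (E : 'M[R]_(n, N)) (m : nat) (P : 'M[R]_(n, N)) : Prop :=
  forall j : 'I_N, gbl_iterate phi L (col j E) m (col j P).

(* For m = 0 the only node is 0, since pi * 0 / 0 = 0. *)
Definition cheb_node (R : realType) (Lam : R) (m j : nat) : R :=
  Lam / 2 * (1 - cos (pi * j%:R / m%:R)).

Definition cheb_interp (R : realType) (phi : R -> R) (Lam : R) (m : nat)
    (p : {poly R}) : Prop :=
  (size p <= m.+1)%N /\
  forall j : nat, (j <= m)%N -> p.[cheb_node Lam m j] = phi (cheb_node Lam m j).

Inductive kr_method := Cbl | Gbl | Sbl | Cheb | Cheb2.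

(* P is (a value of) p_{phi,m-1}^(kr)(L) E, for m >= 1. *)
Definition kr_iterate (R : realType) (n N : nat) (kr : kr_method)
    (phi : R -> R) (Lam : R) (L : 'M[R]_n.+1) (E : 'M[R]_(n.+1, N)) (m : nat)
    (P : 'M[R]_(n.+1, N)) : Prop :=
  match kr with
  | Cbl => cbl_iterate phi L E m P
  | Gbl => gbl_iterate phi L E m P
  | Sbl => sbl_iterate phi L E m P
  | Cheb => exists2 p : {poly R},
      cheb_interp phi Lam m.-1 p & P = horner_mx L p *m E
  | Cheb2 => exists2 p : {poly R},
      cheb_interp (fun x => Num.sqrt (phi x)) Lam (m.-1)./2 p
      & P = horner_mx L (p ^+ 2) *m E
  end.

(* Main.v *)
Require Import Defs.
From mathcomp Require Import ring lra.
From mathcomp Require Import complex.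

(** Write [A = phi(L) E], [A' = P m], [D = A - A'] and
    [mu = phimin + gamma N]. The bound holds for every approximation of [A]
    whose error [delta], the spectral norm of [D], is at most [mu / 2];
    convergence provides this for large [m].

    The spectral theorem gives [phi(L) = U diag(phi(d)) U^T] with the
    eigenvalues [d] in [[0, Lam]], so [phi(L)] is bounded below by [phimin] as
    a quadratic form and above by [phimax] in norm. As [E] has orthonormal
    columns, the regularized matrix [K = E^T A + gamma N I] satisfies
    [mu |x| <= |K x|]. Passing to [A'] changes [K] by [E^T D], of norm at most
    [delta], so the perturbed system stays invertible, and its solution [c']
    satisfies [mu |c - c'| <= delta |c'|]. Splitting
    [A c - A' c' = A (c - c') + D c'] gives
    [|y - y'| <= (1 + phimax / mu) delta |c'|], and [|c'|] exceeds
    [|c| <= |yy| / mu] only by a term of order [delta], which is where the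
    quadratic term comes from: see [rls_predictor_perturbation].

    The real spectral theorem [symmetric_diagonalization] is proved by
    deflation: a complex eigenvalue exists and is real, and a Householder
    reflection moves its eigenvector to the first basis vector. *)

Set Implicit Arguments.
Unset Strict Implicit.
Unset Printing Implicit Defensive.

Local Open Scope classical_set_scope.
Local Open Scope ring_scope.

(** * The Euclidean norm *)

Lemma l2norm_ge0 (R : realType) (n : nat) (x : 'cV[R]_n) : 0 <= l2norm x.
Proof. exact: sqrtr_ge0. Qed.

Lemma l2norm_sqr (R : realType) (n : nat) (x : 'cV[R]_n) :
  l2norm x ^+ 2 = (x^T *m x) 0 0.
Proof.
rewrite sqr_sqrtr; last by apply: sumr_ge0 => i _; exact: sqr_ge0.
by rewrite mxE; apply: eq_bigr => i _; rewrite mxE.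
Qed.

Lemma ler_l2norm (R : realType) (m n : nat) (x : 'cV[R]_m) (y : 'cV[R]_n)
    (a : R) (a_ge0 : 0 <= a)
    (h : (x^T *m x) 0 0 <= a ^+ 2 * (y^T *m y) 0 0) :
  l2norm x <= a * l2norm y.
Proof.
rewrite -(@ler_pXn2r _ 2) ?nnegrE ?mulr_ge0 ?l2norm_ge0 //.
by rewrite exprMn !l2norm_sqr.
Qed.

Lemma l2norm_eq0 (R : realType) (n : nat) (x : 'cV[R]_n) :
  l2norm x = 0 -> x = 0.
Proof.
move=> /eqP; rewrite sqrtr_eq0 => x0.
apply/matrixP => i j; rewrite (ord1 j) mxE; apply/eqP; rewrite -sqrf_eq0.
have /psumr_eq0P -> // : \sum_k x k 0 ^+ 2 = 0.
  by apply/eqP; rewrite eq_le x0 sumr_ge0 // => k _; exact: sqr_ge0.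
by move=> k _; exact: sqr_ge0.
Qed.

Lemma l2normZ (R : realType) (n : nat) (a : R) (x : 'cV[R]_n) :
  l2norm (a *: x) = `|a| * l2norm x.
Proof.
rewrite /l2norm -sqrtr_sqr -sqrtrM ?sqr_ge0 // mulr_sumr.
by congr Num.sqrt; apply: eq_bigr => i _; rewrite mxE exprMn.
Qed.

Lemma mxDE (R : realType) (m n : nat) (A B : 'M[R]_(m, n)) i j :
  (A + B) i j = A i j + B i j.
Proof. by rewrite mxE. Qed.

Lemma mxNE (R : realType) (m n : nat) (A : 'M[R]_(m, n)) i j :
  (- A) i j = - A i j.
Proof. by rewrite mxE. Qed.

Lemma mxZE (R : realType) (m n : nat) a (A : 'M[R]_(m, n)) i j :
  (a *: A) i j = a * A i j.
Proof. by rewrite mxE. Qed.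

Lemma dotmxC (R : realType) (n : nat) (x y : 'cV[R]_n) :
  (x^T *m y) 0 0 = (y^T *m x) 0 0.
Proof. by rewrite !mxE; apply: eq_bigr => i _; rewrite !mxE mulrC. Qed.

(** For nonzero vectors, the square of [|y| x - |x| y] is nonnegative and
    equals [2 |x| |y| (|x| |y| - x.y)]. *)
Lemma cauchy_schwarz (R : realType) (n : nat) (x y : 'cV[R]_n) :
  (x^T *m y) 0 0 <= l2norm x * l2norm y.
Proof.
have [/eqP/l2norm_eq0 ->|x0] := boolP (l2norm x == 0).
  by rewrite trmx0 mul0mx mxE mulr_ge0 ?l2norm_ge0.
have [/eqP/l2norm_eq0 ->|y0] := boolP (l2norm y == 0).
  by rewrite mulmx0 mxE mulr_ge0 ?l2norm_ge0.
have xy_gt0 : 0 < l2norm x * l2norm y.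
  by rewrite mulr_gt0 // lt0r ?x0 ?y0 l2norm_ge0.
have := sqr_ge0 (l2norm (l2norm y *: x - l2norm x *: y)).
rewrite l2norm_sqr [(_ - _)^T]linearB /= ![(_ *: _)^T]linearZ /=.
rewrite mulmxBl !mulmxBr -!scalemxAl -!scalemxAr.
rewrite !(mxDE, mxNE, mxZE) [(y^T *m x) 0 0]dotmxC -!l2norm_sqr => h.
rewrite -(ler_pM2l xy_gt0); move: h; nra.
Qed.

Lemma l2normD (R : realType) (n : nat) (x y : 'cV[R]_n) :
  l2norm (x + y) <= l2norm x + l2norm y.
Proof.
rewrite -(@ler_pXn2r _ 2) ?nnegrE ?addr_ge0 ?l2norm_ge0 //.
rewrite l2norm_sqr [(_ + _)^T]linearD /= mulmxDl !mulmxDr !mxDE.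
rewrite [(y^T *m x) 0 0]dotmxC.
rewrite -!l2norm_sqr; have := cauchy_schwarz x y; nra.
Qed.

Lemma l2norm_isometry (R : realType) (m n : nat) (U : 'M[R]_(m, n))
    (UU : U^T *m U = 1%:M) (x : 'cV[R]_n) : l2norm (U *m x) = l2norm x.
Proof.
apply/eqP; rewrite -(@eqrXn2 _ 2) ?l2norm_ge0 // !l2norm_sqr trmx_mul.
by rewrite mulmxA -(mulmxA x^T) UU mulmx1.
Qed.

(** [|U^T x|^2 = x . U U^T x <= |x| |U U^T x| = |x| |U^T x|]. *)
Lemma l2norm_coisometry (R : realType) (m n : nat) (U : 'M[R]_(m, n))
    (UU : U^T *m U = 1%:M) (x : 'cV[R]_m) : l2norm (U^T *m x) <= l2norm x.
Proof.
have h : l2norm (U^T *m x) ^+ 2 <= l2norm x * l2norm (U^T *m x).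
  rewrite -[X in _ <= _ * X](l2norm_isometry UU) l2norm_sqr trmx_mul trmxK.
  by rewrite -mulmxA; exact: cauchy_schwarz.
have := l2norm_ge0 (U^T *m x); rewrite le0r => /orP[/eqP -> |p].
  exact: l2norm_ge0.
by rewrite -(ler_pM2r p) -expr2.
Qed.

(** * The spectral norm *)

(** Cauchy-Schwarz, row by row. *)
Lemma l2norm_mul_frobenius (R : realType) (m n : nat) (A : 'M[R]_(m, n))
    (x : 'cV[R]_n) : l2norm (A *m x) <= frobenius_norm A * l2norm x.
Proof.
rewrite -(@ler_pXn2r _ 2) ?nnegrE ?mulr_ge0 ?l2norm_ge0 ?sqrtr_ge0 //.
rewrite exprMn [frobenius_norm A ^+ 2]sqr_sqrtr; last first.
  by apply: sumr_ge0 => i _; apply: sumr_ge0 => j _; exact: sqr_ge0.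
rewrite l2norm_sqr mxE mulr_suml; apply: ler_sum => i _; rewrite mxE -expr2.
have -> : \sum_j A i j ^+ 2 = l2norm (row i A)^T ^+ 2.
  rewrite l2norm_sqr trmxK mxE.
  by apply: eq_bigr => j _; rewrite !mxE expr2.
have -> : (A *m x) i 0 = ((row i A)^T^T *m x) 0 0.
  by rewrite trmxK !mxE; apply: eq_bigr => j _; rewrite mxE.
rewrite -exprMn -[X in X <= _]real_normK ?num_real //.
rewrite ler_pXn2r ?nnegrE ?mulr_ge0 ?l2norm_ge0 // ler_norml cauchy_schwarz.
rewrite andbT lerNl.
have := cauchy_schwarz (- (row i A)^T) x.
rewrite -scaleN1r l2normZ normrN1 mul1r scaleN1r linearN /= mulNmx.
by rewrite [X in X <= _]mxE.
Qed.

Lemma spectral_norm_has_ubound (R : realType) (m n : nat) (A : 'M[R]_(m, n)) :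
  ubound [set l2norm (A *m x) | x in [set x : 'cV[R]_n | l2norm x <= 1]]
    (frobenius_norm A).
Proof.
move=> _ [x /= x1 <-]; apply: le_trans (l2norm_mul_frobenius A x) _.
by rewrite ler_piMr // sqrtr_ge0.
Qed.

Lemma l2norm0 (R : realType) (n : nat) : l2norm (0 : 'cV[R]_n) = 0.
Proof. by rewrite -(scale0r 0) l2normZ normr0 mul0r. Qed.

Lemma spectral_norm_le_frobenius (R : realType) (m n : nat) (A : 'M[R]_(m, n)) :
  spectral_norm A <= frobenius_norm A.
Proof.
apply: ge_sup; last exact: spectral_norm_has_ubound.
by exists (l2norm (A *m 0)), 0 => //=; rewrite l2norm0.
Qed.

Lemma spectral_norm_ge (R : realType) (m n : nat) (A : 'M[R]_(m, n))
    (x : 'cV[R]_n) : l2norm x <= 1 -> l2norm (A *m x) <= spectral_norm A.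
Proof.
move=> x1; apply: ub_le_sup; last by exists x.
by exists (frobenius_norm A); exact: spectral_norm_has_ubound.
Qed.

Lemma l2norm_mul_spectral (R : realType) (m n : nat) (A : 'M[R]_(m, n))
    (x : 'cV[R]_n) : l2norm (A *m x) <= spectral_norm A * l2norm x.
Proof.
have [/eqP/l2norm_eq0 ->|x0] := boolP (l2norm x == 0).
  by rewrite mulmx0 !l2norm0 mulr0.
have p : 0 < l2norm x by rewrite lt0r x0 l2norm_ge0.
have := @spectral_norm_ge _ _ _ A ((l2norm x)^-1 *: x).
rewrite -scalemxAr !l2normZ gtr0_norm ?invr_gt0 // mulVf // => /(_ (lexx _)).
by rewrite ler_pdivrMl // mulrC.
Qed.

Lemma spectral_norm_ge0 (R : realType) (m n : nat) (A : 'M[R]_(m, n)) :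
  0 <= spectral_norm A.
Proof.
apply: le_trans (l2norm_ge0 (A *m 0)) _; apply: spectral_norm_ge.
by rewrite l2norm0.
Qed.

Lemma cvg_spectral_norm (R : realType) (m n : nat) (P : nat -> 'M[R]_(m, n))
    (A : 'M[R]_(m, n)) (e : R) :
  0 < e -> P @ \oo --> A -> \forall k \near \oo, spectral_norm (A - P k) <= e.
Proof.
move=> e0 PA.
(* Entries below [e / c] make the square of the Frobenius norm at most
   [m n (e / c) ^ 2 <= e ^ 2], since [m n <= c ^ 2]. *)
pose c : R := (m * n)%:R + 1.
have c_gt0 : 0 < c by rewrite ltr_wpDl.
have /cvg_ball/(_ (e / c)) := PA; rewrite divr_gt0 // => /(_ isT).
apply: filterS => k [_ /= hk].
apply: le_trans (spectral_norm_le_frobenius _) _.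
rewrite -[leRHS]ger0_norm ?(ltW e0) // -sqrtr_sqr ler_wsqrtr //.
have : \sum_i \sum_j (A - P k) i j ^+ 2
    <= \sum_(i < m) \sum_(j < n) (e / c) ^+ 2.
  apply: ler_sum => i _; apply: ler_sum => j _.
  rewrite -[leLHS]real_normK ?num_real // ler_pXn2r ?nnegrE ?normr_ge0 //.
    by rewrite !mxE ltW // hk.
  by rewrite divr_ge0 // ltW.
move=> /le_trans; apply.
rewrite !sumr_const !card_ord -mulrnA mulnC -mulr_natl expr_div_n mulrCA.
rewrite ler_piMr ?sqr_ge0 // ler_pdivrMr ?exprn_gt0 // mul1r /c.
have : 0 <= (m * n)%:R :> R by [].
nra.
Qed.

(** * The spectral theorem for real symmetric matrices *)

(** The matrix has an eigenvalue over [R[i]], and it is real because a real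
    symmetric matrix is Hermitian: if [v A = a v] then [a v v^* = v A v^*] is
    its own conjugate. Eigenvalues that lie in the base field have
    eigenvectors over it. *)
Lemma symmetric_eigenvalue (R : realType) (n : nat) (A : 'M[R]_n.+1)
    (Asym : A^T = A) : exists a, eigenvalue A a.
Proof.
pose C : numClosedFieldType := complex.complex R.
pose iota : {rmorphism R -> C} := complex.real_complex_def (Phant R).
have iota_real (x : R) : (iota x)^* = iota x.
  by apply/CrealP/complex.complex_realP; exists x.
have [a aP] := @spectral.eigenvalue_closed C _ (map_mx iota A) (ltn0Sn n).
have /eigenvalueP[v vA v0] := aP.
pose v' := (map_mx Num.conj v)^T.
have vv : v *m v' = (\sum_i `|v 0 i| ^+ 2)%:M.
  rewrite [LHS]mx11_scalar; congr (_%:M); rewrite mxE.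
  by apply: eq_bigr => i _; rewrite !mxE normCK.
have s0 : \sum_i `|v 0 i| ^+ 2 != 0.
  apply: contra_neq v0 => /psumr_eq0P vs.
  apply/matrixP => i j; rewrite (ord1 i) mxE; apply/eqP.
  rewrite -normr_eq0 -sqrf_eq0 vs // => k _; exact: exprn_ge0.
have e1 : v *m map_mx iota A *m v' = a *: (v *m v').
  by rewrite vA scalemxAl.
have e2 : v *m map_mx iota A *m v' = a^* *: (v *m v').
  have := congr1 (fun M => (map_mx Num.conj M)^T) e1.
  rewrite /= map_mxZ linearZ /= !map_mxM !trmx_mul /v' !map_trmx !trmxK.
  rewrite -!map_mx_comp [map_mx (_ \o _) v]map_mx_id; last exact: conjCK.
  rewrite Asym (@eq_map_mx _ _ _ _ iota) //.
  by rewrite mulmxA.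
have : a = a^*.
  move: e2; rewrite e1 vv !scale_scalar_mx => /matrixP/(_ 0 0).
  by rewrite !mxE mulr1n => /(mulIf s0).
move=> /esym/CrealP/complex.complex_realP[b ab].
exists b; rewrite -(@eigenvalue_map _ _ iota).
rewrite -[iota b]/(complex.real_complex_def _ b).
by rewrite -ab.
Qed.

(** If [v] differs from [e_0], the reflection in the hyperplane orthogonal to
    [v - e_0] swaps them, because they have the same length. *)
Lemma householder (R : realType) (n : nat) (v : 'cV[R]_n.+1)
    (v1 : v^T *m v = 1%:M) :
  exists H : 'M[R]_n.+1,
    [/\ H^T = H, H *m H = 1%:M & H *m delta_mx 0 0 = v].
Proof.
pose e : 'cV[R]_n.+1 := delta_mx 0 0.
have e1 : e^T *m e = 1%:M.
  rewrite /e trmx_delta mul_delta_mx; apply/matrixP => i j.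
  by rewrite !ord1 !mxE.
pose u := v - e; pose s := (u^T *m u) 0 0.
have us : u^T *m u = s%:M by rewrite [LHS]mx11_scalar.
have [/eqP s0|s0] := boolP (s == 0).
  have u0 : u = 0.
    by apply: l2norm_eq0; apply/eqP; rewrite -sqrf_eq0 l2norm_sqr -/s s0.
  exists 1%:M; rewrite trmx1 !mul1mx; split=> //.
  by move: u0; rewrite /u => /eqP; rewrite subr_eq0 => /eqP ->.
have ue : u^T *m e = (- (s / 2))%:M.
  rewrite [LHS]mx11_scalar; congr (_%:M); rewrite /s.
  rewrite /u [(_ - _)^T]linearB /= !mulmxBl !mulmxBr v1 e1.
  rewrite !(mxDE, mxNE) [(e^T *m v) 0 0]dotmxC !mxE /=.
  by field.
exists (1%:M - (2 / s) *: (u *m u^T)); split.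
- by rewrite [LHS]linearB /= trmx1 [(_ *: _)^T]linearZ /= trmx_mul trmxK.
- rewrite mulmxBl !mulmxBr !mul1mx mulmx1 -scalemxAl -scalemxAr scalerA.
  rewrite mulmxA -(mulmxA u) us mul_mx_scalar -scalemxAl scalerA.
  rewrite -[RHS]addr0 -addrA; congr (_ + _).
  rewrite -opprD -scalerBl -scalerDl.
  rewrite [X in X *: _](_ : _ = 0) ?scale0r ?oppr0 //.
  by field.
rewrite mulmxBl mul1mx -scalemxAl -mulmxA ue mul_mx_scalar scalerA -/e.
have -> : 2 / s * - (s / 2) = -1 by field.
by rewrite scaleN1r opprK /u addrC subrK.
Qed.

(** Deflation: a reflection that sends [e_0] to a unit eigenvector conjugates
    the matrix to one whose first column, and by symmetry first row, is a
    multiple of [e_0]. *)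
Theorem symmetric_diagonalization (R : realType) (n : nat) (A : 'M[R]_n)
    (Asym : A^T = A) :
  exists (U : 'M[R]_n) (d : 'rV[R]_n),
    U^T *m U = 1%:M /\ A = U *m diag_mx d *m U^T.
Proof.
elim: n A Asym => [|n IHn] A Asym.
  by exists 1%:M, 0; split; apply/matrixP => -[].
have [a /eigenvalueP[x xA x0]] := symmetric_eigenvalue Asym.
pose v := (l2norm x^T)^-1 *: x^T.
have r0 : l2norm x^T != 0.
  by apply: contra_neq x0 => /l2norm_eq0 x0; rewrite -[x]trmxK x0 trmx0.
have v1 : v^T *m v = 1%:M.
  rewrite [LHS]mx11_scalar -l2norm_sqr l2normZ normfV ger0_norm ?l2norm_ge0 //.
  by rewrite mulVf // expr1n.
have Av : A *m v = a *: v.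
  by rewrite -scalemxAr -{1}Asym -trmx_mul xA linearZ /= !scalerA mulrC.
have [H [Hsym HH He]] := householder v1.
have Hv : H *m v = delta_mx 0 0 by rewrite -He mulmxA HH mul1mx.
(* [M] is kept abstract so that rewriting its entries leaves them folded, and
   is typed with the size [1 + n] for the block decomposition. *)
have [M ME] : exists M : 'M[R]_(1 + n), M = H *m A *m H.
  by exists (H *m A *m H).
have Msym : M^T = M by rewrite ME !trmx_mul Hsym Asym mulmxA.
have Me : H *m A *m H *m delta_mx 0 0 = a *: (delta_mx 0 0 : 'cV_n.+1).
  by rewrite -2!mulmxA He Av -scalemxAr Hv.
have Mi0 i : M i 0 = a *+ (i == 0).
  have := congr1 (fun B : 'cV_ _ => B i 0) Me.
  rewrite -colE -ME !mxE eqxx andbT => ->.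
  by rewrite mulr_natr.
have M0i i : M 0 i = a *+ (i == 0) by rewrite -{1}Msym mxE.
have Mblock : M = block_mx a%:M 0 0 (drsubmx M).
  rewrite -[LHS](submxK M); congr (block_mx _ _ _ _).
  - apply/matrixP => i j; rewrite !ord1 !mxE.
    by rewrite (_ : lshift n 0 = 0) ?M0i //; exact: val_inj.
  - apply/matrixP => i j; rewrite !ord1 !mxE.
    by rewrite (_ : lshift n 0 = 0) ?M0i //; exact: val_inj.
  apply/matrixP => i j; rewrite !ord1 !mxE.
  by rewrite (_ : lshift n 0 = 0) ?Mi0 //; exact: val_inj.
have [|U' [d' [UU' M'E]]] := IHn (drsubmx M); first by rewrite trmx_drsub Msym.
pose B : 'M[R]_(1 + n) := block_mx 1%:M 0 0 U'.
have BT : B^T = block_mx 1%:M 0 0 U'^T.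
  by rewrite /B tr_block_mx !trmx0 trmx1.
have BB : B^T *m B = 1%:M.
  rewrite BT /B mulmx_block !(mulmx0, mul0mx, addr0, add0r) mulmx1 UU'.
  by rewrite -scalar_mx_block.
have BMB : B *m diag_mx (row_mx a%:M d') *m B^T = M.
  rewrite BT /B diag_mx_row !mulmx_block.
  rewrite !(mulmx0, mul0mx, addr0, add0r, mul1mx, mulmx1) -M'E [RHS]Mblock.
  by congr block_mx; apply/matrixP => i j; rewrite !ord1 !mxE.
exists (H *m B), (row_mx a%:M d'); split.
  by rewrite trmx_mul Hsym mulmxA -(mulmxA B^T) HH mulmx1 BB.
rewrite trmx_mul Hsym !mulmxA -(mulmxA H) -(mulmxA H) BMB ME.
by rewrite !mulmxA HH mul1mx -mulmxA HH mulmx1.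
Qed.

(** * Functions of a symmetric matrix *)

Lemma mxfun_diagonalization (R : realType) (n : nat) (phi : R -> R)
    (A : 'M[R]_n) (Asym : A^T = A) :
  exists (U : 'M[R]_n) (d : 'rV[R]_n),
    [/\ U^T *m U = 1%:M, A = U *m diag_mx d *m U^T
      & mxfun phi A = U *m diag_mx (map_mx phi d) *m U^T].
Proof.
rewrite /mxfun; set S := (X in xget 0 X).
have [U [d [UU AE]]] := symmetric_diagonalization Asym.
apply: (@xgetPex _ 0 S).
by exists (U *m diag_mx (map_mx phi d) *m U^T), U, d.
Qed.

(** The [i]-th row of [U^T] is an eigenvector; it is nonzero because its
    product with the [i]-th column of [U] is 1. *)
Lemma eigenvalue_diagonalization (R : realType) (n : nat) (U : 'M[R]_n)
    (d : 'rV[R]_n) (UU : U^T *m U = 1%:M) (i : 'I_n) :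
  eigenvalue (U *m diag_mx d *m U^T) (d 0 i).
Proof.
apply/eigenvalueP; exists (row i U^T).
  by rewrite -row_mul !mulmxA UU mul1mx row_mul row_diag_mx -scalemxAl -rowE.
apply/eqP => Ui; have := congr1 (fun B : 'M[R]_n => B i i) UU.
have -> : (U^T *m U) i i = (row i U^T *m U) 0 i by rewrite -row_mul !mxE.
by rewrite Ui mul0mx !mxE eqxx => /esym/eqP; rewrite oner_eq0.
Qed.

Lemma diagonalization_quadratic_ge (R : realType) (n : nat) (U : 'M[R]_n)
    (d : 'rV[R]_n) (lo : R) (UU : U^T *m U = 1%:M)
    (lo_le : forall i, lo <= d 0 i) (x : 'cV[R]_n) :
  lo * l2norm x ^+ 2 <= (x^T *m (U *m diag_mx d *m U^T *m x)) 0 0.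
Proof.
have UU' : U^T^T *m U^T = 1%:M by rewrite trmxK; exact: mulmx1C.
rewrite -(l2norm_isometry UU' x) -!mulmxA mulmxA.
rewrite -[x^T *m U]trmxK trmx_mul trmxK.
set z := U^T *m x.
rewrite l2norm_sqr mxE [leRHS]mxE mulr_sumr; apply: ler_sum => i _.
rewrite mul_diag_mx mxE [leRHS](_ : _ = d 0 i * (z i 0 * z i 0)).
  by rewrite mxE -expr2 ler_wpM2r ?sqr_ge0.
by rewrite mxE mulrCA.
Qed.

(** Both factors [U] and [U^T] of the diagonalization are contractions. *)
Lemma diagonalization_norm_le (R : realType) (n : nat) (U : 'M[R]_n)
    (d : 'rV[R]_n) (hi : R) (UU : U^T *m U = 1%:M) (hi_ge0 : 0 <= hi)
    (le_hi : forall i, `|d 0 i| <= hi) (x : 'cV[R]_n) :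
  l2norm (U *m diag_mx d *m U^T *m x) <= hi * l2norm x.
Proof.
rewrite -!mulmxA (l2norm_isometry UU).
apply: le_trans (ler_wpM2l hi_ge0 (l2norm_coisometry UU x)).
apply: ler_l2norm => //; set z := U^T *m x.
rewrite !mxE mulr_sumr; apply: ler_sum => i _.
rewrite mul_diag_mx !mxE -!expr2 exprMn ler_wpM2r ?sqr_ge0 //.
by rewrite -[leLHS]real_normK ?num_real // ler_pXn2r ?nnegrE.
Qed.

(** * Perturbation of the predictor *)

(** Cauchy-Schwarz gives [mu |x|^2 <= x . K x <= |x| |K x|]. *)
Lemma norm_ge_of_quadratic_ge (R : realType) (n : nat) (K : 'M[R]_n) (mu : R)
    (x : 'cV[R]_n) :
  mu * l2norm x ^+ 2 <= (x^T *m (K *m x)) 0 0 ->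
  mu * l2norm x <= l2norm (K *m x).
Proof.
have := l2norm_ge0 x; rewrite le0r => /orP[/eqP -> _|p h].
  by rewrite mulr0 l2norm_ge0.
rewrite -(ler_pM2l p); apply: le_trans (cauchy_schwarz _ _).
by rewrite mulrCA -expr2.
Qed.

Lemma unitmx_of_norm_ge (R : realType) (n : nat) (K : 'M[R]_n) (mu : R)
    (mu_gt0 : 0 < mu)
    (Kge : forall x : 'cV[R]_n, mu * l2norm x <= l2norm (K *m x)) :
  K \in unitmx.
Proof.
rewrite -unitmx_tr -row_free_unit -kermx_eq0; apply/eqP/row_matrixP => i.
rewrite row0; apply: trmx_inj; rewrite trmx0; apply: l2norm_eq0; apply/eqP.
rewrite eq_le l2norm_ge0 andbT -(ler_pM2l mu_gt0) mulr0.
apply: le_trans (Kge _) _.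
by rewrite -{1}[K]trmxK -trmx_mul -row_mul mulmx_ker row0 trmx0 l2norm0.
Qed.

(** Write [K c = yy] and [K' c' = yy] for the two systems and [D = A - A'], so
    that [K - K' = E^T D]. Then [K (c - c') = - E^T D c'], and
    [y - y' = A (c - c') + D c'] gives
    [|y - y'| <= (1 + M / mu) delta |c'|]. Moreover
    [|c'| <= |c| + delta / mu |c'|], where [|c| <= |yy| / mu] and, as
    [delta <= mu / 2], [|c'| <= 2 |c|]; the last two facts bound [|c'|] by
    [|yy| / mu] up to a term of order [delta]. *)
Lemma rls_predictor_perturbation (R : realType) (n N : nat)
    (E A A' : 'M[R]_(n, N)) (gamma : R) (yy : 'cV[R]_N) (y : 'cV[R]_n)
    (mu M delta : R)
    (EE : E^T *m E = 1%:M) (mu_gt0 : 0 < mu) (M_ge0 : 0 <= M)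
    (delta_ge0 : 0 <= delta) (delta_le : delta <= mu / 2)
    (Kge : forall x : 'cV[R]_N,
      mu * l2norm x <= l2norm ((E^T *m A + (gamma * N%:R)%:M) *m x))
    (Ale : forall x : 'cV[R]_N, l2norm (A *m x) <= M * l2norm x)
    (Dle : forall x : 'cV[R]_N, l2norm ((A - A') *m x) <= delta * l2norm x)
    (yP : is_rls_predictor E A gamma yy y) :
  (exists y', is_rls_predictor E A' gamma yy y') /\
  forall y', is_rls_predictor E A' gamma yy y' ->
    l2norm (y - y') <= l2norm yy / mu * (1 + M / mu) * delta
      + 2 * (l2norm yy / mu ^+ 2) * (1 + M / mu) * delta ^+ 2.
Proof.
set K := E^T *m A + _ in Kge.
pose K' := E^T *m A' + (gamma * N%:R)%:M.
have KK' x : K *m x = K' *m x + E^T *m ((A - A') *m x).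
  rewrite mulmxA mulmxBr -mulmxDl /K /K'; congr (_ *m _).
  by rewrite [RHS]addrC addrA subrK.
have ETD x : l2norm (E^T *m ((A - A') *m x)) <= delta * l2norm x.
  exact: le_trans (l2norm_coisometry EE _) (Dle x).
split.
  have K'ge x : mu / 2 * l2norm x <= l2norm (K' *m x).
    have := Kge x; rewrite KK' => /le_trans/(_ (l2normD _ _)) h.
    have := ETD x; have := l2norm_ge0 x; move: h; nra.
  have K'u : K' \in unitmx by apply: unitmx_of_norm_ge K'ge; rewrite divr_gt0.
  by exists (A' *m (invmx K' *m yy)), (invmx K' *m yy); rewrite // mulKVmx.
move=> y' [c' c'P ->]; have [c cP ->] := yP.
rewrite -/K -/K' in cP c'P.
have c_le : mu * l2norm c <= l2norm yy by rewrite -cP.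
have cc_le : mu * l2norm (c - c') <= delta * l2norm c'.
  apply: le_trans (Kge _) _; rewrite mulmxBr cP KK' c'P opprD addrA subrr add0r.
  by rewrite -scaleN1r l2normZ normrN1 mul1r.
have c'_le : l2norm c' <= l2norm c + l2norm (c - c').
  rewrite -{1}[c'](subKr c); apply: le_trans (l2normD _ _) _.
  by rewrite -[- (c - c')]scaleN1r l2normZ normrN1 mul1r.
have yy'_le :
    l2norm (A *m c - A' *m c') <= M * l2norm (c - c') + delta * l2norm c'.
  have -> : A *m c - A' *m c' = A *m (c - c') + (A - A') *m c'.
    by rewrite mulmxBr mulmxBl addrA subrK.
  by apply: le_trans (l2normD _ _) (lerD (Ale _) (Dle _)).
apply: le_trans yy'_le _.
(* What remains is scalar: [b], [t], [t'], [s] stand for the norms of [yy],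
   [c], [c'] and [c - c']. *)
move: (l2norm_ge0 yy) (l2norm_ge0 c) (l2norm_ge0 c') (l2norm_ge0 (c - c')).
move: (l2norm yy) (l2norm c) (l2norm c') (l2norm (c - c')) c_le cc_le c'_le.
move=> b t t' s c_le cc_le c'_le b0 t0 t'0 s0.
have s_le : s <= delta * t' / mu by rewrite ler_pdivlMr // mulrC.
have t_le : t <= b / mu by rewrite ler_pdivlMr // mulrC.
have t'_le2 : t' <= 2 * (b / mu).
  have : delta * t' / mu <= t' / 2.
    by rewrite ler_pdivrMr // mulrAC mulrC [leRHS]mulrAC; nra.
  nra.
have t'_le : t' <= b / mu + 2 * (b / mu ^+ 2) * delta.
  have : delta * t' / mu <= 2 * (b / mu ^+ 2) * delta.
    have -> : 2 * (b / mu ^+ 2) * delta = delta * (2 * (b / mu)) / mu.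
      by field; rewrite gt_eqF.
    by rewrite ler_pM2r ?invr_gt0 // ler_wpM2l.
  nra.
have Mmu : 0 <= M / mu by rewrite divr_ge0 // ltW.
have -> : b / mu * (1 + M / mu) * delta
    + 2 * (b / mu ^+ 2) * (1 + M / mu) * delta ^+ 2
  = (1 + M / mu) * delta * (b / mu + 2 * (b / mu ^+ 2) * delta) by ring.
apply: (@le_trans _ _ ((1 + M / mu) * delta * t')); last first.
  by rewrite ler_wpM2l // mulr_ge0 // addr_ge0.
have : M * s <= M * (delta * t' / mu) by rewrite ler_wpM2l.
lra.
Qed.

Lemma unit_block_orthonormal (R : realType) (n N : nat) (w : 'I_N -> 'I_n)
    (w_inj : injective w) : (unit_block R w)^T *m unit_block R w = 1%:M.
Proof.
apply/matrixP => i j; rewrite !mxE (bigD1 (w i)) //= !mxE eqxx mul1r.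
rewrite (inj_eq w_inj) big1 ?addr0 // => k /negPf kw.
by rewrite !mxE kw mul0r.
Qed.

Theorem theorem5p1 (R : realType) (n N : nat) (L : 'M[R]_n.+1) (Lam : R)
    (w : 'I_N -> 'I_n.+1) (yy : 'cV[R]_N) (gamma : R) (kr : kr_method)
    (phi : R -> R) (phimin phimax : R) (P : nat -> 'M[R]_(n.+1, N))
    (y : 'cV[R]_n.+1)
    (Lsym : L^T = L)
    (Lspec : forall a : R, eigenvalue L a -> 0 <= a <= Lam)
    (Lam_gt0 : 0 < Lam)
    (w_inj : injective w)
    (gamma_ge0 : 0 <= gamma)
    (phi_cont : {within `[0, Lam], continuous phi})
    (phi_gt0 : forall x : R, x \in `[0, Lam] -> 0 < phi x)
    (phiminP : is_min [set `|phi x| | x in `[0, Lam]] phimin)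
    (phimaxP : is_max [set `|phi x| | x in `[0, Lam]] phimax)
    (PP : forall m : nat, (0 < m)%N ->
      kr_iterate kr phi Lam L (unit_block R w) m (P m))
    (P_cvg : P @ \oo --> mxfun phi L *m unit_block R w)
    (yP : is_rls_predictor (unit_block R w) (mxfun phi L *m unit_block R w)
            gamma yy y) :
  let delta (m : nat) :=
    spectral_norm (mxfun phi L *m unit_block R w - P m) in
  exists C : R, \forall m \near \oo,
    (exists ykr, is_rls_predictor (unit_block R w) (P m) gamma yy ykr) /\
    forall ykr, is_rls_predictor (unit_block R w) (P m) gamma yy ykr ->
      l2norm (y - ykr)
        <= l2norm yy / (phimin + gamma * N%:R)
             * (1 + phimax / (phimin + gamma * N%:R)) * delta m
           + C * delta m ^+ 2.
Proof.
move=> delta; set E := unit_block R w in PP P_cvg yP delta *.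
set mu := phimin + gamma * N%:R.
have EE : E^T *m E = 1%:M := unit_block_orthonormal R w_inj.
have [[x0 x0P phimin_x0] phimin_le] := phiminP.
have [[x1 x1P phimax_x1] le_phimax] := phimaxP.
have phimin_gt0 : 0 < phimin.
  by rewrite -phimin_x0 normr_gt0 gt_eqF // phi_gt0 // inE.
have phimax_ge0 : 0 <= phimax by rewrite -phimax_x1.
have mu_gt0 : 0 < mu by rewrite ltr_pwDl // mulr_ge0.
have [U [d [UU LE phiLE]]] := mxfun_diagonalization phi Lsym.
have dP i : d 0 i \in `[0, Lam].
  rewrite in_itv /=; apply: Lspec; rewrite LE.
  exact: eigenvalue_diagonalization.
have lo i : phimin <= map_mx phi d 0 i.
  rewrite mxE -[leRHS]gtr0_norm ?phi_gt0 //; apply: phimin_le.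
  by exists (d 0 i) => //; exact: dP.
have hi i : `|map_mx phi d 0 i| <= phimax.
  by rewrite mxE; apply: le_phimax; exists (d 0 i) => //; exact: dP.
exists (2 * (l2norm yy / mu ^+ 2) * (1 + phimax / mu)).
have := cvg_spectral_norm (e := mu / 2) _ P_cvg.
rewrite divr_gt0 // => /(_ isT); apply: filterS => m delta_le.
apply: (rls_predictor_perturbation EE mu_gt0 phimax_ge0 (spectral_norm_ge0 _)
  delta_le) yP => x; last exact: l2norm_mul_spectral.
- apply: norm_ge_of_quadratic_ge.
  rewrite mulmxDl mulmxDr mxDE mul_scalar_mx -scalemxAr mxZE -l2norm_sqr.
  rewrite mulrDl lerD2r -(l2norm_isometry EE x) -!mulmxA mulmxA -trmx_mul phiLE.
  exact: diagonalization_quadratic_ge.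
- rewrite -mulmxA -(l2norm_isometry EE x) phiLE.
  exact: diagonalization_norm_le.
Qed.
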